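(* $L(2,2)=1$, and $L(2,n)=2n-1$ for every integer $n\ge 3$.
   Context: Let $m,n$ be integers with $2\le m\le n$. An $m$ by $n$ array consists of $mn$ cells arranged in $m$ rows and $n$ columns, each cell containing exactly one symbol (symbols are arbitrary and may repeat). A transversal of an array consists of $m$ cells, one from each row and no two from the same column. A latin transversal is a transversal in which no symbol appears more than once. $L(m,n)$ denotes the largest integer such that every $m$ by $n$ array in which each symbol appears at most $L(m,n)$ times has a latin transversal. *)

(* Defs.v *)
From mathcomp Require Import all_boot all_algebra.
From mathcomp Require classical_sets.

Set Implicit Arguments.
Unset Strict Implicit.
Unset Printing Implicit Defensive.

(* An array is a matrix with entries in an arbitrary eqType of symbols; a cell
   is a pair (row, column). *)

Definition symbol_cells (S : eqType) (m n : nat) (A : 'M[S]_(m, n)) (s : S) :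
    {set 'I_m * 'I_n} :=
  [set c | A c.1 c.2 == s].

(* One cell in each row (hence m cells in all), no two in the same column. *)
Definition array_transversal (m n : nat) (T : {set 'I_m * 'I_n}) : Prop :=
  (forall i : 'I_m, #|[set c in T | c.1 == i]| = 1) /\
  {in T &, injective (fun c : 'I_m * 'I_n => c.2)}.

Definition latin_transversal (S : eqType) (m n : nat) (A : 'M[S]_(m, n))
    (T : {set 'I_m * 'I_n}) : Prop :=
  array_transversal T /\
  {in T &, injective (fun c : 'I_m * 'I_n => A c.1 c.2)}.

Definition forces_latin_transversal (m n k : nat) : Prop :=
  forall (S : eqType) (A : 'M[S]_(m, n)),
    (forall s : S, #|symbol_cells A s| <= k) ->
    exists T : {set 'I_m * 'I_n}, latin_transversal A T.

Definition is_largest (P : nat -> Prop) (k : nat) : Prop :=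
  P k /\ forall j : nat, P j -> j <= k.

(* The largest k exists when 2 <= m <= n: k = 0 qualifies vacuously, and no
   k >= m * n does because of the constant array.  Otherwise the value 0
   is a default, so a positive value of L is always a genuine maximum. *)
Definition L (m n : nat) : nat :=
  classical_sets.xget 0 (is_largest (forces_latin_transversal m n)).

(* Main.v *)
Require Import Defs.
From mathcomp Require Import all_boot all_algebra.

(** A latin transversal of a two-row array [A] is a pair of distinct columns
    [a], [b] with [A ord0 a <> A ord_max b] (lemma [latin_transversal2P]).

    If no such pair exists, the entry of the first row in column [a] equals
    every entry of the second row outside column [a].  With at least three
    columns, any two columns [a], [a'] of the first row avoid a common third
    column, so the first row is constant, and then so is the whole array
    (lemma [no_latin_transversal2_const]): a symbol occurs [2 * n] times.
    Conversely the constant array has no latin transversal, so [2 * n - 1] is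
    optimal.  With two columns this argument breaks down: the latin square of
    order two has no latin transversal and uses each symbol twice, whereas an
    array without repetition clearly has one. *)

Set Implicit Arguments.
Unset Strict Implicit.
Unset Printing Implicit Defensive.

Lemma L_eq (m n k : nat) :
  is_largest (forces_latin_transversal m n) k -> L m n = k.
Proof.
move=> Hk; apply: classical_sets.xget_unique => // j [Pj maxj].
have [Pk maxk] := Hk.
by apply/eqP; rewrite eqn_leq maxk // maxj.
Qed.

Lemma ord2_cases (i : 'I_2) : i = ord0 \/ i = ord_max.
Proof. by case: i => [[|[|//]] lt_i]; [left | right]; apply: val_inj. Qed.

Lemma latin_transversal2P (S : eqType) (n : nat) (A : 'M[S]_(2, n)) :
  (exists T, latin_transversal A T) <->
  (exists a b : 'I_n, a != b /\ A ord0 a != A ord_max b).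
Proof.
split=> [[T [[rowT colT] symT]] | [a [b [neq_ab neqA]]]].
  have cell_in_row i : exists a, (i, a) \in T.
    have /card_gt0P[[i' a]] : 0 < #|[set c in T | c.1 == i]| by rewrite rowT.
    by rewrite inE /= => /andP[Tc /eqP <-]; exists a.
  have [a Ta] := cell_in_row ord0; have [b Tb] := cell_in_row ord_max.
  exists a, b; split; apply/eqP => eq_ab.
    by have := colT _ _ Ta Tb eq_ab.
  by have := symT _ _ Ta Tb eq_ab.
exists [set (ord0, a); (ord_max, b)]; split; first split.
- move=> i; case: (ord2_cases i) => ->.
    apply/eqP/cards1P; exists (ord0, a); apply/setP => c.
    rewrite !inE andb_orl; case: (c =P (ord0, a)) => [-> //|_] /=.
    by case: (c =P (ord_max, b)) => [-> |].
  apply/eqP/cards1P; exists (ord_max, b); apply/setP => c.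
  rewrite !inE andb_orl; case: (c =P (ord_max, b)) => [->|_] /=.
    by rewrite eqxx.
  by case: (c =P (ord0, a)) => [-> |].
- move=> c d; rewrite !inE => /orP[]/eqP-> /orP[]/eqP-> //= eq_ab.
    by rewrite eq_ab eqxx in neq_ab.
  by rewrite eq_ab eqxx in neq_ab.
- move=> c d; rewrite !inE => /orP[]/eqP-> /orP[]/eqP-> //= eqA.
    by rewrite eqA eqxx in neqA.
  by rewrite eqA eqxx in neqA.
Qed.

(** Any two columns leave a third one free. *)
Lemma ord_avoid2 (n : nat) (a b : 'I_n) :
  3 <= n -> exists c : 'I_n, a != c /\ b != c.
Proof.
move=> n_ge3.
have /card_gt0P[c] : 0 < #|~: [set a; b]|.
  rewrite -(ltn_add2l #|[set a; b]|) addn0 cardsC card_ord cards2.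
  by apply: leq_trans n_ge3; case: (a != b).
rewrite !inE negb_or ![c == _]eq_sym => /andP[neq_ac neq_bc].
by exists c.
Qed.

Lemma no_latin_transversal2_const (S : eqType) (n : nat) (A : 'M[S]_(2, n)) :
    3 <= n -> (forall a b : 'I_n, a != b -> A ord0 a = A ord_max b) ->
  exists s, forall i j, A i j = s.
Proof.
move=> n_ge3 eqA.
pose a0 := Ordinal (leq_trans (isT : 0 < 3) n_ge3).
have row0 a : A ord0 a = A ord0 a0.
  by have [b [neq_ab neq_a0b]] := ord_avoid2 a a0 n_ge3; rewrite !(eqA _ b).
exists (A ord0 a0) => i j; case: (ord2_cases i) => -> //.
by have [a [neq_ja _]] := ord_avoid2 j j n_ge3; rewrite -(eqA a) // eq_sym.
Qed.

Lemma forces_latin_transversal2 (n : nat) :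
  3 <= n -> forces_latin_transversal 2 n (2 * n - 1).
Proof.
move=> n_ge3 S A leA; apply/latin_transversal2P.
case: (boolP [exists a, exists b, (a != b) && (A ord0 a != A ord_max b)]).
  by case/existsP=> a /existsP[b /andP[neq_ab neqA]]; exists a, b.
rewrite negb_exists => /forallP noT.
have [|s eq_s] := no_latin_transversal2_const n_ge3 (A := A).
  move=> a b neq_ab; apply/eqP; have := noT a.
  by rewrite negb_exists => /forallP/(_ b); rewrite neq_ab negbK.
have := leA s; have -> : symbol_cells A s = setT.
  by apply/setP => c; rewrite !inE eq_s eqxx.
rewrite cardsT card_prod !card_ord leqNgt subn1 prednK ?leqnn //.
by rewrite muln_gt0 (leq_trans _ n_ge3).
Qed.

(** The constant array bounds [L 2 n] from above. *)
Lemma forces_latin_transversal2_lt (n k : nat) :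
  forces_latin_transversal 2 n k -> k < 2 * n.
Proof.
move=> Pk; rewrite ltnNge; apply/negP => le_k.
have le_const s : #|symbol_cells (const_mx tt : 'M_(2, n)) s| <= k.
  apply: leq_trans le_k.
  by rewrite (leq_trans (max_card _)) // card_prod !card_ord.
have /latin_transversal2P[a [b [_]]] := Pk _ _ le_const.
by rewrite !mxE eqxx.
Qed.

Lemma forces_latin_transversal22 : forces_latin_transversal 2 2 1.
Proof.
move=> S A leA; apply/latin_transversal2P.
exists ord0, ord_max; split=> //; apply/eqP => eqA.
have := leA (A ord0 ord0); apply/negP; rewrite -ltnNge.
by apply/card_gt1P; exists (ord0, ord0), (ord_max, ord_max); rewrite !inE /= eqA.
Qed.

(** The latin square of order two bounds [L 2 2] from above. *)
Lemma forces_latin_transversal22_le1 (k : nat) :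
  forces_latin_transversal 2 2 k -> k <= 1.
Proof.
move=> Pk; rewrite leqNgt; apply/negP => k_gt1.
pose A : 'M_2 := (\matrix_(i, j) (i == j))%R.
have leA s : #|symbol_cells A s| <= k.
  apply: leq_trans k_gt1.
  (* A cell holding [s] is determined by its row. *)
  have injT : {in symbol_cells A s &,
      injective (fun c : 'I_2 * 'I_2 => c.1)}.
    move=> [i j] [i' j']; rewrite !inE !mxE /= => /eqP<- + eq_i.
    rewrite -{i'}eq_i => /eqP; case: (ord2_cases i) => ->.
      by case: (ord2_cases j) => ->; case: (ord2_cases j') => ->.
    by case: (ord2_cases j) => ->; case: (ord2_cases j') => ->.
  by rewrite -(card_in_imset injT) (leq_trans (max_card _)) // card_ord.
have /latin_transversal2P[a [b []]] := Pk _ _ leA.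
rewrite !mxE.
by case: (ord2_cases a) => ->; case: (ord2_cases b) => ->.
Qed.

Theorem mainTheorem5 :
  L 2 2 = 1 /\ (forall n : nat, 3 <= n -> L 2 n = 2 * n - 1).
Proof.
split=> [|n n_ge3]; apply: L_eq; split.
- exact: forces_latin_transversal22.
- exact: forces_latin_transversal22_le1.
- exact: forces_latin_transversal2.
- move=> j /forces_latin_transversal2_lt lt_j.
  by rewrite subn1 -ltnS prednK // (leq_trans _ lt_j).
Qed.
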